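(* Let $(E,+,{}',0,1)$ be an effect algebra whose induced order $\leq$ satisfies the Ascending Chain Condition, and for $x,y\in E$ define the (set-valued) implication $x\rightarrow y:=y+\operatorname{Max}L(x',y')=\{y+z: z\in\operatorname{Max}L(x',y')\}$, and for $A\subseteq E$ put $x\rightarrow A:=\bigcup_{z\in A}(x\rightarrow z)$. Then for all $a,b\in E$: (i) $a\leq b$ if and only if $a\rightarrow b=\{1\}$; (ii) if $a\leq b'$ then $a'\rightarrow b=\{a+b\}$; (iii) if $a\geq b$ then $a\rightarrow b=\{a'+b\}$; (iv) if $a\geq b$ then $a\rightarrow b=b'\rightarrow a'$; (v) $a\rightarrow0=\{a'\}$; (vi) $1\rightarrow a=\{a\}$; (vii) $b'\rightarrow\operatorname{Max}L(a',b')=a\rightarrow b$.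
   Context: An effect algebra is a structure $(E,+,{}',0,1)$ where $E$ is a set, ${}'$ is a unary operation on $E$, $0,1\in E$, and $+$ is a partial binary operation on $E$ such that for all $x,y,z\in E$: (E1) if $x+y$ is defined then so is $y+x$ and $x+y=y+x$; (E2) $(x+y)+z$ is defined if and only if $x+(y+z)$ is defined, and then they are equal; (E3) $x+y$ is defined and equals $1$ if and only if $y=x'$; (E4) if $1+x$ is defined then $x=0$. The induced order is $x\leq y$ iff there exists $z$ with $x+z=y$; it is a partial order with bounds $0,1$. The Ascending Chain Condition means there is no infinite strictly ascending chain in $(E,\leq)$. $L(x,y):=\{z\in E: z\leq x \text{ and } z\leq y\}$ is the lower cone, and $\operatorname{Max}A$ denotes the set of maximal elements of $A\subseteq E$ with respect to $\leq$. (Every element of $\operatorname{Max}L(x',y')$ is $\leq y'$, so $y+z$ is defined for it.) *)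

(* Defs.v *)
From mathcomp Require Import all_boot.
From mathcomp Require Import classical_sets.

Set Implicit Arguments.
Unset Strict Implicit.
Unset Printing Implicit Defensive.

Local Open Scope classical_set_scope.

(* The partial sum is option-valued: [eplus x y = None] means that x + y is
   undefined.  In [eplusA] both sides are Kleene sums: one side is defined
   iff the other one is, and then their values agree. *)
Record effectAlgebra : Type := EffectAlgebra {
  ecarrier :> Type;
  eplus : ecarrier -> ecarrier -> option ecarrier;
  ecompl : ecarrier -> ecarrier;
  ezero : ecarrier;
  eone : ecarrier;
  eplusC : forall x y s, eplus x y = Some s -> eplus y x = Some s;
  eplusA : forall x y z,
    obind (fun s => eplus s z) (eplus x y) =
    obind (fun t => eplus x t) (eplus y z);
  eplus_eone : forall x y, eplus x y = Some eone <-> y = ecompl x;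
  eone_eplus : forall x, isSome (eplus eone x) -> x = ezero
}.

Arguments ezero {e}.
Arguments eone {e}.

Section EffectAlgebraTheory.
Variable E : effectAlgebra.
Implicit Types (x y z : E) (A : set E).

Definition ele x y : Prop := exists z, eplus x z = Some y.

Definition elt x y : Prop := ele x y /\ x <> y.

Definition ascending_chain_condition : Prop :=
  ~ exists u : nat -> E, forall n, elt (u n) (u n.+1).

Definition lower_cone x y : set E := [set z | ele z x /\ ele z y].

Definition Max A : set E :=
  [set z | A z /\ forall w, A w -> ele z w -> w = z].

(* The translate y + A keeps only the sums that are defined; in [eimp] below
   all of them are, see [eplus_Max_lower_cone]. *)
Definition eplus_set y A : set E :=
  [set s | exists2 z, A z & eplus y z = Some s].

Definition eimp x y : set E :=
  eplus_set y (Max (lower_cone (ecompl x) (ecompl y))).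

Definition eimp_set x A : set E := \bigcup_(z in A) eimp x z.

Lemma eplus_Max_lower_cone x y z :
  Max (lower_cone (ecompl x) (ecompl y)) z -> exists s, eplus y z = Some s.
Proof.
case=> -[_ [w zw]] _.
have /= := eplusA y z w; rewrite zw /=.
have -> : eplus y (ecompl y) = Some eone by apply/eplus_eone.
by case: (eplus y z) => [s _|//]; exists s.
Qed.

End EffectAlgebraTheory.

Arguments ascending_chain_condition : clear implicits.

(* Main.v *)
(* When x <= y, the lower cone of x and y has the single maximal element x.
   In (i)-(vi) the order hypothesis makes the two arguments of the cone
   comparable (the converse of (i) is y + z = 1 iff z = y'), and in (vii) every z in Max L(a',b') satisfies b <= z', whence
   b' -> z = {z + b}. *)
Require Import Defs.
From mathcomp Require Import all_boot.
From mathcomp Require Import classical_sets.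

Local Open Scope classical_set_scope.

Section EffectAlgebra.
Set Implicit Arguments.
Unset Strict Implicit.

Variable E : effectAlgebra.
Implicit Types x y z s : E.

Lemma eplus_ecompl x : eplus x (ecompl x) = Some eone.
Proof. exact/eplus_eone. Qed.

Lemma ecomplK x : ecompl (ecompl x) = x.
Proof. by apply/esym/eplus_eone/eplusC/eplus_ecompl. Qed.

Lemma ecompl1 : ecompl eone = ezero :> E.
Proof. by apply: eone_eplus; rewrite eplus_ecompl. Qed.

Lemma ecompl0 : ecompl ezero = eone :> E.
Proof. by rewrite -ecompl1 ecomplK. Qed.

(** As 0 = 1', the sum (x' + x) + 0 = 1 + 0 is defined and equals 1. Reassociating gives x' + (x +
    0) = 1, which forces x + 0 = x''. *)
Lemma eplusx0 x : eplus x ezero = Some x.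
Proof.
have := eplusA (ecompl x) x ezero.
rewrite (eplusC (eplus_ecompl x)) /= -{1}ecompl1 eplus_ecompl.
case: (eplus x ezero) => //= s /esym /eplus_eone ->.
by rewrite ecomplK.
Qed.

Lemma eplus0x x : eplus ezero x = Some x.
Proof. exact/eplusC/eplusx0. Qed.

(** Since 1 + (x + y) = 1 + 0 is defined, so is 1 + x, and [eone_eplus] applies. *)
Lemma eplus_eq0 x y : eplus x y = Some ezero -> x = ezero.
Proof.
move=> xy; have := eplusA eone x y; rewrite xy /= eplusx0.
by case x1: (eplus eone x) => [s|//] _; apply: eone_eplus; rewrite x1.
Qed.

Lemma eplus_cancel x y z s :
  eplus x y = Some s -> eplus x z = Some s -> y = z.
Proof.
(* From t + x = s follows t + (x + s') = s + s' = 1, so x + s' = t'. Thus x and s alone determine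
   t', hence t. *)
have sub t : eplus x t = Some s -> eplus x (ecompl s) = Some (ecompl t).
  move/eplusC => tx; have := eplusA t x (ecompl s).
  rewrite tx /= eplus_ecompl; case: (eplus x (ecompl s)) => //= u.
  by move/esym/eplus_eone => ->.
by move=> /sub ys /sub; rewrite ys => -[yz]; rewrite -(ecomplK y) yz ecomplK.
Qed.

Lemma ele_refl x : ele x x.
Proof. by exists ezero; exact: eplusx0. Qed.

(** If x + u = y and y + v = x, then x + (u + v) = x; cancellation gives u + v = 0, so u = 0. *)
Lemma ele_anti x y : ele x y -> ele y x -> x = y.
Proof.
move=> [u xu] [v yv].
have := eplusA x u v; rewrite xu /= yv.
case uv: (eplus u v) => [w|//] /= /esym xw.
move: uv; rewrite (eplus_cancel xw (eplusx0 x)) => /eplus_eq0 u0.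
by move: xu; rewrite u0 eplusx0 => -[].
Qed.

Lemma ele0x x : ele ezero x.
Proof. by exists x; exact: eplus0x. Qed.

Lemma elex1 x : ele x eone.
Proof. by exists (ecompl x); exact: eplus_ecompl. Qed.

(** If x + z = y, then x + (z + y') = y + y' = 1, so z + y' = x': the same z witnesses both
    inequalities. *)
Lemma ele_ecompl x y : ele x y -> ele (ecompl y) (ecompl x).
Proof.
move=> [z xz]; have := eplusA x z (ecompl y).
rewrite xz /= eplus_ecompl; case zy: (eplus z (ecompl y)) => [t|//] /=.
by move=> /esym/eplus_eone tx; exists z; rewrite -tx; exact: eplusC.
Qed.

Lemma lower_coneC x y : lower_cone x y = lower_cone y x.
Proof. by apply/seteqP; split=> z []. Qed.

(** Here x lies in the cone and bounds it from above, so it is its greatest element. *)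
Lemma Max_lower_cone x y : ele x y -> Max (lower_cone x y) = [set x].
Proof.
move=> xy; have xL : lower_cone x y x by split; [exact: ele_refl|].
apply/seteqP; split=> z /=.
  by move=> -[[zx _] zmax]; rewrite (zmax x xL zx).
by move=> ->; split=> // w [wx _] xw; exact: ele_anti.
Qed.

Lemma eplus_set1 x y s : eplus x y = Some s -> eplus_set x [set y] = [set s].
Proof.
move=> xy; apply/seteqP; split=> t /=.
  by move=> [z /= ->]; rewrite xy => -[].
by move=> ->; exists y.
Qed.

Lemma eimp_ge x y : ele y x ->
  exists2 s, eplus (ecompl x) y = Some s & eimp x y = [set s].
Proof.
move=> /ele_ecompl xy; have Mxy := Max_lower_cone xy.
have /eplus_Max_lower_cone[s yx] :
  Max (lower_cone (ecompl x) (ecompl y)) (ecompl x) by rewrite Mxy.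
by exists s; [exact: eplusC|rewrite /eimp Mxy; exact: eplus_set1].
Qed.

Lemma eimp_le x y : ele x y -> eimp x y = [set eone].
Proof.
(* Now y' is the smaller complement, so the cone is swapped to expose y' as its only maximal
   element. *)
move=> /ele_ecompl yx; rewrite /eimp lower_coneC (Max_lower_cone yx).
exact/eplus_set1/eplus_ecompl.
Qed.

Lemma eimp1_le x y : eimp x y eone -> ele x y.
Proof.
move=> [z [[zx _] _] /eplus_eone zy].
by rewrite -(ecomplK x) -(ecomplK y); apply: ele_ecompl; rewrite -zy.
Qed.

(** By [eimp_ge] both sides are singletons, of x' + y and of y'' + x'. *)
Lemma eimp_ecompl x y : ele y x -> eimp x y = eimp (ecompl y) (ecompl x).
Proof.
move=> yx; have [s xy ->] := eimp_ge yx.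
have [t] := eimp_ge (ele_ecompl yx).
by rewrite ecomplK (eplusC xy) => -[->] ->.
Qed.

Lemma eimpx0 x : eimp x ezero = [set ecompl x].
Proof. by have [s] := eimp_ge (ele0x x); rewrite eplusx0 => -[<-]. Qed.

Lemma eimp1x x : eimp eone x = [set x].
Proof. by have [s] := eimp_ge (elex1 x); rewrite ecompl1 eplus0x => -[<-]. Qed.

Lemma eimp_set_Max x y :
  eimp_set (ecompl y) (Max (lower_cone (ecompl x) (ecompl y))) = eimp x y.
Proof.
apply/seteqP; split=> s.
  move=> [z zM zs]; exists z => //; have [[_ zy] _] := zM.
  have [t] := eimp_ge zy; rewrite ecomplK => yz yzt.
  by move: zs; rewrite yzt /= => ->.
move=> [z zM yz]; exists z => //; have [[_ zy] _] := zM.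
by have [t] := eimp_ge zy; rewrite ecomplK yz => -[->] ->.
Qed.

End EffectAlgebra.

Theorem theorem5p1 (E : effectAlgebra) (acc : ascending_chain_condition E) :
  forall a b : E,
  (ele a b <-> eimp a b = [set eone]) /\
  (ele a (ecompl b) ->
     exists2 s : E, eplus a b = Some s & eimp (ecompl a) b = [set s]) /\
  (ele b a ->
     exists2 s : E, eplus (ecompl a) b = Some s & eimp a b = [set s]) /\
  (ele b a -> eimp a b = eimp (ecompl b) (ecompl a)) /\
  (eimp a ezero = [set ecompl a]) /\
  (eimp eone a = [set a]) /\
  (eimp_set (ecompl b) (Max (lower_cone (ecompl a) (ecompl b))) = eimp a b).
Proof.
move=> a b; split.
  by split=> [|ab]; [exact: eimp_le|apply: eimp1_le; rewrite ab].
split.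
  (* Complementing a <= b' gives b <= a', so [eimp_ge] applies with a' in place of a. *)
  by move=> /ele_ecompl; rewrite ecomplK => /eimp_ge; rewrite ecomplK.
split; first exact: eimp_ge.
split; first exact: eimp_ecompl.
split; first exact: eimpx0.
split; first exact: eimp1x.
exact: eimp_set_Max.
Qed.
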